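(* Let $N\ge 3$ be odd, let $\bar V$ be the symplectic $F$-vector space with circular basis $\{\bar e_s;s\in S\}$, $|S|=N$, described in the context, and fix $t\in S$. For $B\in\phi(\bar V)$ let $B^t=\{I\in\mathcal{I}; I\subset S-\{t\},\ \bar e_I\in L_B\}$; for $s\in S-\{t\}$ let $$f_s(B)=|\{I\in B^t\cap\mathcal{I}^1;s\in I\}|-|\{I\in B^t\cap\mathcal{I}^0;s\in I\}|-\underline{|B^t\cap\mathcal{I}^0|},$$ where for $m\in\mathbb{Z}$ we set $\underline m=0$ if $m$ is even and $\underline m=1$ if $m$ is odd; and let $$\epsilon'(B)=\sum_{s\in S-\{t\}}\tfrac12 f_s(B)(f_s(B)+1)\,\bar e_s\in\bar V.$$ Then for any $B\in\phi(\bar V)$, $$\epsilon'(B)=\sum_{s\in S}\tfrac12 g_s(B)(g_s(B)+1)\,\bar e_s,$$ where $g_s(B)=|\{I\in B;s\in I\}|$ (all integer coefficients being reduced modulo $2$).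
   Context: $F=\mathbb{Z}/2$; $N\ge3$ is odd. $(S,\mathfrak{E})$ is a graph which is a cycle with $N$ vertices. $V$ is an $F$-vector space with basis $\{e_s;s\in S\}$ and symplectic (alternating bilinear) form with, for $s\ne s'$, $\langle e_s,e_{s'}\rangle=1$ if $\{s,s'\}\in\mathfrak{E}$ and $0$ otherwise. $\bar V=V/F e_S$, $e_S=\sum_{s\in S}e_s$, with induced form; $\bar e_s$ is the image of $e_s$; $\bar e_I=\sum_{s\in I}\bar e_s$ for $I\subset S$. For $I\subset S$, $\underline I$ is the full subgraph on $I$. $\mathcal{I}$ is the set of $I\subset S$ with $\underline I$ a path with $m\ge1$ vertices; $\mathcal{I}^1=\{I\in\mathcal{I};|I|\text{ odd}\}$, $\mathcal{I}^0=\{I\in\mathcal{I};|I|\text{ even}\}$. For $I,I'\in\mathcal{I}^1$: $I\prec I'$ means $I\subsetneq I'$ and $\underline{I'-I}$ is disconnected; $I\spadesuit I'$ means $I\cap I'=\emptyset$ and $\underline{I\cup I'}$ is disconnected. For $I\in\mathcal{I}^1$, $I^{ev}$ is the set of $s\in I$ with $I-\{s\}=I'\sqcup I''$, $I',I''\in\mathcal{I}^1$, $I'\spadesuit I''$. $R$ is the set of finite subsets of $\mathcal{I}^1$; for $B\in R$, $L_B\subset\bar V$ is the subspace spanned by $\{\bar e_I;I\in B\}$. $\phi(\bar V)$ is the set of $B\in R$ such that: $(P_0)$ if $I,I'\in B$ then $I=I'$ or $I\spadesuit I'$ or $I\prec I'$ or $I'\prec I$; $(P_1)$ for each $I\in B$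 there are pairwise disjoint $I_1,\dots,I_k\in B$ ($k\ge0$) with all $I_j\prec I$ and $I^{ev}\subset I_1\cup\dots\cup I_k$. *)

(* Defs.v *)
From HB Require Import structures.
From mathcomp Require Import all_boot all_order all_algebra.

Set Implicit Arguments.
Unset Strict Implicit.
Unset Printing Implicit Defensive.

Import GRing.Theory.
Local Open Scope ring_scope.
Local Open Scope quotient_scope.
Import VectorInternalTheory.

(* The library's additive quotient {quot U} of a finite-dimensional space V by
   a subspace U, equipped with its vector space structure. *)
Section QuotientSpace.

Variables (K : fieldType) (V : vectType K) (U : {vspace V}).

Definition vquot : Type := Quotient.quot (pred_of_vspace U).
HB.instance Definition _ := GRing.Zmodule.on vquot.
HB.instance Definition _ := EqQuotient.on vquot.
HB.instance Definition _ := ZmodQuotient.on vquot.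

Definition vquot_pi (x : V) : vquot := \pi_vquot x.

Lemma vquot_piP x y : (vquot_pi x == vquot_pi y) = (x - y \in U).
Proof. by rewrite -Quotient.idealrBE. Qed.

Lemma vquotW (P : vquot -> Prop) :
  (forall x, P (vquot_pi x)) -> forall x, P x.
Proof. exact: quotW. Qed.

Definition vquot_scale (a : K) (x : vquot) : vquot := vquot_pi (a *: repr x).

Lemma vquot_scaleE a x : vquot_scale a (vquot_pi x) = vquot_pi (a *: x).
Proof.
apply/eqP; rewrite vquot_piP -scalerBr memvZ //.
by rewrite -vquot_piP /vquot_pi reprK.
Qed.

Lemma vquot_piD : {morph vquot_pi : x y / x + y}.
Proof. by move=> x y; rewrite /vquot_pi raddfD. Qed.

Lemma vquot_scaleA a b x :
  vquot_scale a (vquot_scale b x) = vquot_scale (a * b) x.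
Proof. by elim/vquotW: x => x; rewrite !vquot_scaleE scalerA. Qed.

Lemma vquot_scale1 : left_id 1 vquot_scale.
Proof. by elim/vquotW=> x; rewrite vquot_scaleE scale1r. Qed.

Lemma vquot_scaleDr : right_distributive vquot_scale +%R.
Proof.
move=> a; elim/vquotW=> x; elim/vquotW=> y.
by rewrite -vquot_piD !vquot_scaleE scalerDr vquot_piD.
Qed.

Lemma vquot_scaleDl x : {morph vquot_scale^~ x : a b / a + b}.
Proof.
by elim/vquotW: x => x a b; rewrite !vquot_scaleE scalerDl vquot_piD.
Qed.

HB.instance Definition _ := GRing.Zmodule_isLmodule.Build K vquot
  vquot_scaleA vquot_scale1 vquot_scaleDr vquot_scaleDl.

Lemma vquot_pi_is_linear : linear vquot_pi.
Proof. by move=> a x y; rewrite vquot_piD -vquot_scaleE. Qed.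

HB.instance Definition _ :=
  GRing.isLinear.Build K V vquot _ vquot_pi vquot_pi_is_linear.

(* Finite dimension: V / U is identified with the complement U^C. *)
Let W := (U^C)%VS.
Let compl (x : V) : subvs_of W := vsproj W (daddv_pi W U x).

Let WU0 : (W :&: U = 0)%VS. Proof. by rewrite capvC capv_compl. Qed.

Let complK x : x - vsval (compl x) \in U.
Proof.
have xWU : x \in (W + U)%VS by rewrite addvC addv_complf memvf.
rewrite /compl vsprojK ?memv_pi // -{1}(daddv_pi_add WU0 xWU) addrAC subrr.
by rewrite add0r memv_pi.
Qed.

Let compl_inj x y : (compl x == compl y) = (x - y \in U).
Proof.
apply/eqP/idP=> [exy|Uxy].
  rewrite -(subrKA (vsval (compl x))) memvD ?complK // exy.
  by rewrite -opprB memvN complK.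
apply/eqP; rewrite -subr_eq0 -linearB /=; apply/eqP/val_inj => /=.
rewrite vsprojK -linearB ?memv_pi //=.
set z := x - y in Uxy *; apply/eqP; rewrite -memv0 -WU0 memv_cap memv_pi /=.
rewrite -[daddv_pi _ _ _](subKr z) memvB //.
by have:= complK z; rewrite /compl vsprojK ?memv_pi.
Qed.

Lemma vquot_vect_axiom : Vector.axiom (dim (subvs_of W)) vquot.
Proof.
pose h (x : vquot) := v2r (compl (repr x)).
have hE x : h (vquot_pi x) = v2r (compl x).
  by congr v2r; apply/eqP; rewrite compl_inj -vquot_piP /vquot_pi reprK.
exists h => [a|].
  elim/vquotW=> x; elim/vquotW=> y.
  by rewrite -[_ *: _ + _]vquot_pi_is_linear !hE /compl !linearP.
exists (fun r => vquot_pi (vsval (r2v r))).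
  elim/vquotW=> x; rewrite hE v2rK; apply/eqP.
  by rewrite vquot_piP -opprB memvN complK.
move=> r; rewrite hE; apply: (canLR r2vK); apply: val_inj => /=.
by rewrite /compl vsprojK ?memv_pi // daddv_pi_id // subvsP.
Qed.

HB.instance Definition _ := Lmodule_hasFinDim.Build K vquot vquot_vect_axiom.

End QuotientSpace.

Section CircularSpace.

Variables (S : finType) (e : rel S).

(* (S, e) is isomorphic to the cycle graph on 'I_n (n >= 3 is required for this
   to be a simple cycle); ordS is the successor modulo n. *)
Definition is_cycle_graph (n : nat) : Prop :=
  exists2 f : 'I_n -> S, bijective f &
    forall i j, e (f i) (f j) = (j == ordS i) || (i == ordS j).

(* The full subgraph on I is isomorphic to the path graph on #|I| >= 1
   vertices. *)
Definition is_path (I : {set S}) : bool :=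
  (I != set0) &&
  [exists f : {ffun 'I_#|I| -> S},
    [&& injectiveb f, f @: [set: 'I_#|I|] == I &
        [forall i, forall j,
           e (f i) (f j) == ((i.+1 == j :> nat) || (j.+1 == i :> nat))]]].

Definition induced (I : {set S}) : rel S :=
  [rel x y | [&& x \in I, y \in I & e x y]].

Definition disconnected (I : {set S}) : bool :=
  [exists x in I, exists y in I, ~~ connect (induced I) x y].

Definition paths : {set {set S}} := [set I | is_path I].
Definition paths1 : {set {set S}} := [set I in paths | odd #|I|].
Definition paths0 : {set {set S}} := [set I in paths | ~~ odd #|I|].

Definition prec (I J : {set S}) : bool := (I \proper J) && disconnected (J :\: I).
Definition spade (I J : {set S}) : bool :=
  [disjoint I & J] && disconnected (I :|: J).

Definition evpart (I : {set S}) : {set S} :=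
  [set s in I | [exists J in paths1, exists J' in paths1,
                   (I :\ s == J :|: J') && spade J J']].

Definition P0 (B : {set {set S}}) : Prop :=
  forall I J, I \in B -> J \in B -> [|| I == J, spade I J, prec I J | prec J I].

(* The pairwise disjoint family I_1, ..., I_k is the set of sets C. *)
Definition P1 (B : {set {set S}}) : Prop :=
  forall I, I \in B -> exists C : {set {set S}},
    [/\ C \subset B, trivIset C, forall J, J \in C -> prec J I
      & evpart I \subset cover C].

Definition phi (B : {set {set S}}) : Prop :=
  [/\ B \subset paths1, P0 B & P1 B].

(* ('F_2)^o is 'F_2 seen as a vector space over itself. *)
Definition V : vectType 'F_2 := {ffun S -> ('F_2)^o}.
Definition ebase (s : S) : V := [ffun x => (x == s)%:R].
Definition eS : V := \sum_(s : S) ebase s.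

(* The bilinear form with <e_s, e_s'> = 1 if {s, s'} is an edge, else 0. *)
Definition form (v w : V) : 'F_2 :=
  \sum_(s : S) \sum_(s' : S) (v s : 'F_2) * w s' * (e s s')%:R.

Definition Vbar : vectType 'F_2 := vquot <[eS]>%VS.
Definition ebar (s : S) : Vbar := vquot_pi <[eS]>%VS (ebase s).
Definition ebarI (I : {set S}) : Vbar := \sum_(s in I) ebar s.

Definition formbar (x y : Vbar) : 'F_2 :=
  form (repr (x : vquot <[eS]>%VS)) (repr (y : vquot <[eS]>%VS)).

Lemma formbarE n (v w : V) : (2 < n)%N -> is_cycle_graph n ->
  formbar (vquot_pi <[eS]>%VS v) (vquot_pi <[eS]>%VS w) = form v w.
Proof.
move=> n_gt2 [f f_bij eE].
have e_sym : symmetric e.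
  case: f_bij => g fK gK x y; rewrite -[x]gK -[y]gK !eE orbC.
  by rewrite [in RHS]orbC orbC.
have form_sym u u' : form u u' = form u' u.
  rewrite /form exchange_big; apply: eq_bigr => s _; apply: eq_bigr => s' _.
  by rewrite e_sym [_ s' * _]mulrC.
have formB u u' z : form (u - u') z = form u z - form u' z.
  rewrite /form -sumrB; apply: eq_bigr => s _; rewrite -sumrB.
  by apply: eq_bigr => s' _; rewrite !ffunE !mulrBl.
have deg2 s : \sum_(s' : S) (e s s')%:R = 0 :> 'F_2.
  case: (f_bij) => g fK gK; rewrite -[s]gK; set i := g s.
  rewrite (reindex f) /=; last exact: onW_bij.
  under eq_bigr => j _ do rewrite eE.
  have ij : ordS i != ord_pred i.
    apply/eqP => /(congr1 (@ordS n)) /(congr1 val).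
    rewrite ord_predK /= -[((i.+1 %% n).+1)%N]addn1 modnDml addn1.
    move/eqP; rewrite -[X in _ == X](modn_small (ltn_ord i)) -addn2.
    by rewrite -[X in _ == (X %% n)%N]addn0 eqn_modDl mod0n modn_small.
  rewrite (bigD1 (ordS i)) //= (bigD1 (ord_pred i)) 1?eq_sym //=.
  rewrite eqxx ord_predK eqxx orbT big1 ?addr0 => [|j /andP[jS jP]].
    by apply/eqP.
  rewrite (negPf jS) /=; case: eqP => // ij'.
  by rewrite ij' ordSK eqxx in jP.
have form_eS u k : form u (k *: eS) = 0.
  rewrite /form big1 // => s _.
  transitivity (u s * k * \sum_(s' : S) (e s s')%:R); last by rewrite deg2 mulr0.
  rewrite mulr_sumr; apply: eq_bigr => s' _; congr (_ * _ * _).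
  rewrite /eS !ffunE sum_ffunE (bigD1 s') //= big1 => [|x xs'].
    by rewrite ffunE eqxx addr0; exact: mulr1.
  by rewrite ffunE eq_sym (negPf xs').
have dU u : exists k, repr (\pi_(vquot <[eS]>%VS) u) - u = k *: eS.
  by apply/vlineP; rewrite -vquot_piP /vquot_pi reprK.
rewrite /formbar /vquot_pi.
have [k kE] := dU v; have [l lE] := dU w.
rewrite -(subrK (form v (repr (\pi_(vquot <[eS]>%VS) w))) (form _ _)) -formB kE.
rewrite form_sym form_eS add0r form_sym.
rewrite -[LHS](subrK (form w v)) -formB lE form_sym form_eS add0r.
exact: form_sym.
Qed.

Definition L (B : {set {set S}}) : {vspace Vbar} :=
  <<[seq ebarI J | J in B]>>%VS.

Definition Bt (t : S) (B : {set {set S}}) : {set {set S}} :=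
  [set I in paths | (I \subset [set~ t]) && (ebarI I \in L B)].

Definition parity (m : int) : int := if (2 %| m)%Z then 0 else 1.

Definition fcount (t : S) (B : {set {set S}}) (s : S) : int :=
  #|[set I in Bt t B :&: paths1 | s \in I]|%:Z
  - #|[set I in Bt t B :&: paths0 | s \in I]|%:Z
  - parity #|Bt t B :&: paths0|%:Z.

Definition gcount (B : {set {set S}}) (s : S) : int :=
  #|[set I in B | s \in I]|%:Z.

(* m (m + 1) / 2 reduced modulo 2; the integer division is exact. *)
Definition half_mod2 (m : int) : 'F_2 := ((m * (m + 1)) %/ 2)%Z%:~R.

Definition eps' (t : S) (B : {set {set S}}) : Vbar :=
  \sum_(s in [set~ t]) half_mod2 (fcount t B s) *: ebar s.

End CircularSpace.

(* Main.v *)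
(* Let bd X be the set of edges of the cycle joining X to its complement; it
   determines X up to complementation, and X is a path iff bd X has two elements.
   If I, J are distinct members of B, then the symmetric difference of I and J is
   disconnected, so its boundary has more than two edges, and bd I, bd J are
   disjoint. The boundary kills e_S, hence is defined on Vbar: if the class of a
   path X lies in L_B, then bd X is a sum of disjoint pairs bd J, so it equals one
   of them and X is J or its complement. Hence B^t consists of the I in B avoiding
   t and of the complements of the I in B containing t, which gives
   f_s = g_s - 2k with 2k = g_t or g_t + 1. Finally m (m + 1) / 2 changes by k
   modulo 2 when m is replaced by m - 2k, it vanishes at m = f_t, and the
   correction k (\sum_s ebar s) is 0. *)
Require Import Defs.
From mathcomp Require Import all_boot all_order all_algebra.
From mathcomp Require Import zify ring.

Set Implicit Arguments.
Unset Strict Implicit.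
Unset Printing Implicit Defensive.

Import GRing.Theory.

(** * Linear algebra in [Vbar] over the field with two elements *)

Section Linear.

Local Open Scope ring_scope.
Variable S : finType.
Implicit Types (B : {set {set S}}) (I J X : {set S}).

Definition proj : {linear V S -> Vbar S} := vquot_pi <[eS S]>%VS.

Lemma proj_eq0 (v : V S) : (proj v == 0) = (v \in <[eS S]>%VS).
Proof. by rewrite -(linear0 proj) /proj /= vquot_piP subr0. Qed.

Lemma sum_ebar : \sum_s ebar s = 0 :> Vbar S.
Proof.
transitivity (proj (eS S)); first by rewrite [X in proj X]/eS linear_sum.
by apply/eqP; rewrite proj_eq0 memv_line.
Qed.

Lemma addVbarK (x : Vbar S) : x + x = 0.
Proof.
by rewrite -mulr2n -scaler_nat (_ : 2%:R = 0 :> 'F_2) ?scale0r //; apply/eqP.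
Qed.

Lemma ebarI_setC X : ebarI (~: X) = ebarI X.
Proof.
apply: (addIr (ebarI X)); rewrite addVbarK -sum_ebar [RHS](bigID (mem X)) addrC /=.
by congr (_ + _); apply: eq_bigl => x; rewrite inE.
Qed.

Definition indicator X : V S := [ffun x => (x \in X)%:R].

Lemma ebarIE X : ebarI X = proj (indicator X).
Proof.
transitivity (proj (\sum_(s in X) ebase s)); first by rewrite linear_sum.
congr (proj _); apply/ffunP => x.
rewrite sum_ffunE ffunE big_mkcond /= (bigD1 x) //= ffunE eqxx.
rewrite big1 ?addr0 => [|y yx]; first by case: (x \in X).
by rewrite ffunE eq_sym (negbTE yx); case: ifP.
Qed.

(** As a function on [S], [eS] is the constant 1. *)
Lemma line_eS_const (v : V S) x y : v \in <[eS S]>%VS -> v x = v y.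
Proof.
case/vlineP => k ->; rewrite !ffunE /eS !sum_ffunE; congr (_ *: _).
have one z : \sum_i ebase i z = 1 :> ('F_2)^o.
  rewrite (bigD1 z) //= ffunE eqxx big1 ?addr0 // => u uz.
  by rewrite ffunE eq_sym (negbTE uz).
by rewrite !one.
Qed.

Lemma mem_L B (v : Vbar S) : v \in L B ->
  exists c : {set S} -> 'F_2, v = \sum_(J in B) c J *: ebarI J.
Proof.
rewrite /L span_def big_map big_enum /= => /memv_sumP[vs vsP ->].
have lineP J : J \in B -> exists k : 'F_2, vs J == k *: ebarI J.
  by move=> /vsP/vlineP[k ->]; exists k.
(* The default 0 is never reached for [J] in [B], by [lineP]. *)
exists (fun J => odflt 0 [pick k : 'F_2 | vs J == k *: ebarI J]).
apply: eq_bigr => J JB; case: pickP => [k /eqP //|no].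
by have [k] := lineP J JB; rewrite no.
Qed.

Lemma natr_bool_neq (a b : bool) : (a != b)%:R = a%:R - b%:R :> 'F_2.
Proof. by case: a; case: b; apply/eqP. Qed.

(** A lift of the relation to [V] holds up to a multiple of [eS]; being constant, it cancels in the
    difference of the values at [x] and [y]. Taking [y] to be the successor of [x] gives the
    linearity of the boundary. *)
Lemma ebarI_comb_neq B X (c : {set S} -> 'F_2) x y :
    ebarI X = \sum_(J in B) c J *: ebarI J ->
  ((x \in X) != (y \in X))%:R =
    \sum_(J in B) c J * ((x \in J) != (y \in J))%:R :> 'F_2.
Proof.
move=> E; pose w : V S := \sum_(J in B) c J *: indicator J.
have : proj (indicator X - w) == 0.
  rewrite linearB linear_sum /= -ebarIE E subr_eq0; apply/eqP/eq_bigr => J _.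
  by rewrite linearZ /= ebarIE.
have wE z : w z = \sum_(J in B) c J * (z \in J)%:R :> 'F_2.
  by rewrite /w sum_ffunE; apply: eq_bigr => J _; rewrite !ffunE.
rewrite proj_eq0 => /(line_eS_const x y); rewrite !ffunE !wE.
move/eqP; rewrite subr_eq addrAC -addrA addrC -subr_eq => /eqP.
rewrite natr_bool_neq => ->; rewrite -sumrB; apply: eq_bigr => J _.
by rewrite natr_bool_neq mulrBr.
Qed.

End Linear.

(** * Arcs and boundaries on a cycle given by its successor map *)

Section Cycle.

Variables (S : finType) (e : rel S) (nx : S -> S).
Hypothesis nx_inj : injective nx.
Hypothesis nx_conn : forall x y, fconnect nx x y.
Hypothesis eE : forall x y, e x y = (y == nx x) || (x == nx y).
Hypothesis S_gt2 : 2 < #|S|.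

Implicit Types (a x y : S) (X Y I J : {set S}).

Definition pos a x := findex nx a x.

Definition arc a m := [set x | pos a x < m].

(* The edge {x, nx x} is encoded by its endpoint x. *)
Definition bd X := [set x | (x \in X) != (nx x \in X)].

Lemma e_sym : symmetric e.
Proof. by move=> x y; rewrite !eE orbC. Qed.

Lemma order_nx a : order nx a = #|S|.
Proof. by apply: eq_card => x; rewrite !inE nx_conn. Qed.

Lemma posK a x : iter (pos a x) nx a = x.
Proof. exact: iter_findex. Qed.

Lemma pos_lt a x : pos a x < #|S|.
Proof. by rewrite -(order_nx a) findex_max. Qed.

Lemma pos_iter a i : i < #|S| -> pos a (iter i nx a) = i.
Proof. by move=> iN; rewrite /pos findex_iter // order_nx. Qed.

Lemma pos0 a : pos a a = 0.
Proof. exact: findex0. Qed.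

Lemma pos_inj a : injective (pos a).
Proof. by move=> x y E; rewrite -(posK a x) E posK. Qed.

Lemma pos_nx a x :
  pos a (nx x) = if (pos a x).+1 < #|S| then (pos a x).+1 else 0.
Proof.
rewrite -{1}(posK a x) -iterS; case: ifP => [|E]; first exact: pos_iter.
have -> : (pos a x).+1 = order nx a by rewrite order_nx; have:= pos_lt a x; lia.
by rewrite iter_order // pos0.
Qed.

Lemma bdC X : bd (~: X) = bd X.
Proof. by apply/setP => x; rewrite !inE (inj_eq negb_inj). Qed.

Lemma mem_bd X x : (x \in bd X) = ((x \in X) != (nx x \in X)).
Proof. by rewrite inE. Qed.

Lemma bd0 : bd set0 = set0.
Proof. by apply/setP => x; rewrite !inE. Qed.

(** Equal boundaries make membership in the symmetric difference invariant under [nx], hence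
    constant on the single orbit. *)
Lemma bd_inj X Y : bd X = bd Y -> X = Y \/ X = ~: Y.
Proof.
move=> XY.
have nxP x : (nx x \in X) (+) (nx x \in Y) = (x \in X) (+) (x \in Y).
  move/setP/(_ x): XY; rewrite !inE.
  by do 4!case: (_ \in _).
have memP a x : (x \in X) (+) (x \in Y) = (a \in X) (+) (a \in Y).
  by rewrite -(posK a x); elim: (pos a x) => //= i <-.
have [a _|S0] := pickP (@predT S); last by left; apply/setP => x; have := S0 x.
case E : ((a \in X) (+) (a \in Y)).
  right; apply/setP => x; move: (memP a x); rewrite E inE.
  by do 2!case: (_ \in _).
left; apply/setP => x; move: (memP a x); rewrite E.
by do 2!case: (_ \in _).
Qed.

Lemma mem_arc a m i : i < #|S| -> (iter i nx a \in arc a m) = (i < m).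
Proof. by move=> iN; rewrite inE pos_iter. Qed.

Lemma arc_connected a m : ~~ disconnected e (arc a m).
Proof.
apply/existsP => -[x /andP[xA /existsP[y /andP[yA]]]]; case/negP.
have ind_sym : connect_sym (induced e (arc a m)).
  by apply: sym_connect_sym => u v; rewrite /induced /= e_sym andbCA.
have from_a z : z \in arc a m -> connect (induced e (arc a m)) a z.
  rewrite inE -{2}(posK a z); have:= pos_lt a z.
  elim: (pos a z) => [|i IH] iN im //=.
  apply: connect_trans (IH _ _) _; try lia.
  apply: connect1; apply/and3P; rewrite -iterS; split; last by rewrite eE eqxx.
    by rewrite mem_arc; lia.
  by rewrite mem_arc; lia.
by apply: connect_trans (from_a _ yA); rewrite ind_sym from_a.
Qed.

(** One boundary edge leaves the last vertex of the arc, at position [m.-1]; the other enters [a]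
    from its predecessor, at position [#|S|.-1]. *)
Lemma bd_arc a m : 0 < m < #|S| ->
  bd (arc a m) = [set iter m.-1 nx a; iter #|S|.-1 nx a].
Proof.
move=> mN; apply/setP => x.
rewrite !inE pos_nx -!(inj_eq (@pos_inj a)) !pos_iter; try lia.
move: #|S| (pos a x) (pos_lt a x) mN => n p pn mn.
by case: (ltnP p.+1 n) => ?; case: (ltnP p m) => ?; case: ltnP => ? /=; lia.
Qed.

Lemma card_bd_arc a m : 0 < m < #|S| -> #|bd (arc a m)| = 2.
Proof.
by move=> mN; rewrite bd_arc // cards2 -(inj_eq (@pos_inj a)) !pos_iter; lia.
Qed.

(** Start at a vertex [a] of [X] whose predecessor [z] is outside [X], and stop when the walk first
    leaves [X]; both ends of this run are boundary edges of [X]. *)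
Lemma exists_run X : X != set0 -> X != setT ->
  exists a m, [/\ 0 < m < #|S|, arc a m \subset X & bd (arc a m) \subset bd X].
Proof.
case/set0Pn=> b bX XnT.
have [z /andP[zX aX]] : exists z, (z \notin X) && (nx z \in X).
  (* Without such a [z] the complement of [X] is stable under [nx], so a point of it would lead to
     [b]. *)
  apply/existsP; apply: contraR XnT; rewrite negb_exists => /forallP H.
  apply/eqP/setP => x; rewrite inE; apply: contraTT bX => xX.
  rewrite -(posK x b); elim: (pos x b) => //= i IH.
  by move: (H (iter i nx x)); rewrite IH.
set a := nx z in aX *.
have zE : iter #|S|.-1 nx a = z.
  apply: nx_inj; rewrite -iterS prednK; last by lia.
  by rewrite -(order_nx a) iter_order.
have exm : exists m, iter m nx a \notin X by exists #|S|.-1; rewrite zE.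
case: (ex_minnP exm) => m mX mmin.
have mlt : m < #|S| by have := mmin #|S|.-1; rewrite zE => /(_ zX); lia.
have m0 : 0 < m by case: m mX {mmin mlt} => //=; rewrite aX.
have subX i : i < m -> iter i nx a \in X.
  by move=> im; apply: contraLR im => /mmin; rewrite -leqNgt.
exists a, m; split; first by rewrite m0.
  by apply/subsetP => x; rewrite inE -{2}(posK a x) => /subX.
rewrite bd_arc ?m0 //; apply/subsetP => x; rewrite !inE => /orP[] /eqP ->.
  by rewrite -iterS prednK // subX ?(negbTE mX) //; lia.
by rewrite zE (negbTE zX) aX.
Qed.

(** A run in [X] already accounts for two boundary edges, so it has the boundary of [X]; it is not
    the complement of [X], as it meets [X] in [a]. *)
Lemma arc_of_bd X : X != set0 -> X != setT -> #|bd X| <= 2 ->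
  exists a m, 0 < m < #|S| /\ X = arc a m.
Proof.
move=> X0 XnT bd2; have [a [m [mN aX bX]]] := exists_run X0 XnT.
exists a, m; split=> //.
have aA : a \in arc a m by rewrite inE pos0; lia.
have/eqP/bd_inj[-> // | AX] : bd (arc a m) == bd X.
  by rewrite eqEcard bX card_bd_arc.
by have := subsetP aX a aA; move: aA; rewrite {1}AX inE => /negbTE ->.
Qed.

(** * Paths are the sets with two boundary edges *)

Lemma arc_path a m : 0 < m < #|S| -> is_path e (arc a m).
Proof.
move=> mN.
have AE : arc a m = [set iter i nx a | i : 'I_m].
  apply/setP => x; rewrite inE; apply/idP/imsetP => [xm | [i _ ->]].
    by exists (Ordinal xm) => //=; rewrite posK.
  by rewrite pos_iter; have := ltn_ord i; lia.
have inj_it : injective (fun i : 'I_m => iter i nx a).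
  move=> i j /(congr1 (pos a)); have := ltn_ord i; have := ltn_ord j.
  by move=> jm im; rewrite !pos_iter; try lia; apply: val_inj.
have cA : #|arc a m| = m by rewrite AE card_imset // card_ord.
have ltm (i : 'I_#|arc a m|) : i < m by rewrite -[X in _ < X]cA.
apply/andP; split; first by rewrite -card_gt0 cA; lia.
apply/existsP; exists [ffun i : 'I_#|arc a m| => iter i nx a].
apply/and3P; split.
- apply/injectiveP => i j; rewrite !ffunE => E.
  exact/val_inj/(congr1 val (inj_it (Ordinal (ltm i)) (Ordinal (ltm j)) E)).
- apply/eqP/setP => x; apply/imsetP/idP => [[i _ ->] | xA].
    by rewrite ffunE mem_arc //; have := ltm i; lia.
  have xm : pos a x < #|arc a m| by move: xA; rewrite cA inE.
  by exists (Ordinal xm) => //; rewrite ffunE /= posK.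
- apply/forallP => i; apply/forallP => j; apply/eqP; rewrite !ffunE eE.
  (* Since [m < #|S|], the successors of the vertices of the arc do not wrap around to [a]. *)
  have im := ltm i; have jm := ltm j.
  by rewrite -!iterS -!(inj_eq (@pos_inj a)) !pos_iter; lia.
Qed.

(** If a path filled the cycle, both neighbours of its first vertex would have index 1, hence
    coincide, which [#|S| > 2] excludes. *)
Lemma path_neqT X : is_path e X -> X != setT.
Proof.
case/andP => X0 /existsP[h /and3P[/injectiveP hi /eqP hX /forallP he]].
apply/eqP => XT; have cX : 0 < #|X| by rewrite card_gt0.
pose o := Ordinal cX.
have h_onto x : exists i, h i = x.
  have : x \in h @: [set: 'I_#|X|].
    by rewrite hX; move/setP/(_ x): XT => ->; rewrite inE.
  by case/imsetP => i _ ->; exists i.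
have [i hiE] := h_onto (nx (h o)).
pose w := iter #|S|.-1 nx (h o).
have wE : nx w = h o.
  by rewrite /w -iterS prednK -?(order_nx (h o)) ?iter_order // order_nx; lia.
have [j hjE] := h_onto w.
have i1 : i = 1 :> nat.
  by have /forallP/(_ i)/eqP := he o; rewrite eE hiE eqxx /=; lia.
have j1 : j = 1 :> nat.
  by have /forallP/(_ j)/eqP := he o; rewrite eE hjE wE eqxx orbT /=; lia.
have : nx (h o) = w by rewrite -hiE -hjE; congr (h _); apply: ord_inj; rewrite i1.
by move/(congr1 (pos (h o))); rewrite (@pos_iter _ 1) ?pos_iter; lia.
Qed.

(** This is the connectedness of a path: membership in [Y] passes between consecutive indices in
    both directions. *)
Lemma path_closed X Y : is_path e X -> Y \subset X -> Y != set0 ->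
  (forall x y, x \in Y -> y \in X -> e x y -> y \in Y) -> Y = X.
Proof.
case/andP => X0 /existsP[h /and3P[/injectiveP hi /eqP hX /forallP he]] YX.
case/set0Pn=> y yY cl.
have hmem i : h i \in X by move/setP/(_ (h i)): hX => <-; apply: imset_f.
have h_onto x : x \in X -> exists i, h i = x.
  by move/setP/(_ x): hX => <- /imsetP[i _ ->]; exists i.
have cX : 0 < #|X| by rewrite card_gt0.
have all0 n (nX : n < #|X|) : (h (Ordinal nX) \in Y) = (h (Ordinal cX) \in Y).
  elim: n nX => [|n IH] nX; first by rewrite (bool_irrelevance nX cX).
  rewrite -(IH (ltnW nX)); set i := Ordinal _; set j := Ordinal _.
  have /forallP/(_ i)/eqP := he j; rewrite /= eqxx => eji.
  apply/idP/idP => M; apply: (cl _ _ M (hmem _)); first by rewrite e_sym eji.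
  by rewrite eji.
apply/eqP; rewrite eqEsubset YX; apply/subsetP => x.
move=> /h_onto[[j jX] <-]; have [[i iX] yE] := h_onto y (subsetP YX y yY).
by rewrite all0 -(all0 i iX) yE.
Qed.

(** An edge from a run to the rest of [X] would be a boundary edge of the run but not of [X]; so the
    run is all of [X] by [path_closed]. *)
Lemma path_card_bd X : is_path e X -> #|bd X| = 2.
Proof.
move=> pX; have [X0 _] := andP pX.
have [a [m [mN aX bX]]] := exists_run X0 (path_neqT pX).
suff <- : arc a m = X by rewrite card_bd_arc.
apply: path_closed => //.
  by apply/set0Pn; exists a; rewrite inE pos0; lia.
move=> x y xA yX; have xX := subsetP aX x xA.
rewrite eE => /orP[] /eqP E; apply: contraTT isT => yA.
  have /(subsetP bX) : x \in bd (arc a m) by rewrite mem_bd -E xA (negbTE yA).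
  by rewrite mem_bd -E xX yX.
have /(subsetP bX) : y \in bd (arc a m) by rewrite mem_bd -E xA (negbTE yA).
by rewrite mem_bd -E xX yX.
Qed.

Lemma path_of_bd X : #|bd X| = 2 -> is_path e X.
Proof.
move=> b2; have [|||a [m [mN ->]]] := @arc_of_bd X; last exact: arc_path.
- by apply: contra_eq_neq b2 => ->; rewrite bd0 cards0.
- by apply: contra_eq_neq b2 => ->; rewrite -setC0 bdC bd0 cards0.
- by rewrite b2.
Qed.

Lemma connected_of_bd X : #|bd X| <= 2 -> ~~ disconnected e X.
Proof.
move=> b2; case: (eqVneq X set0) => [-> | X0].
  by apply/existsP => -[x]; rewrite inE.
case: (eqVneq X setT) => [-> | XnT]; last first.
  by have [a [m [_ ->]]] := arc_of_bd X0 XnT b2; apply: arc_connected.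
have [a _] := set0Pn _ X0; suff -> : setT = arc a #|S| by apply: arc_connected.
by apply/setP => x; rewrite !inE pos_lt.
Qed.

(** * Boundaries of the members of [B] are disjoint *)

Definition symdiff X Y := (X :\: Y) :|: (Y :\: X).

Lemma bd_symdiff X Y : bd (symdiff X Y) = symdiff (bd X) (bd Y).
Proof. by apply/setP => x; rewrite !inE; do 4!case: (_ \in _). Qed.

(** A common boundary edge leaves at most one edge on each side in the boundary of the symmetric
    difference, which is then connected. *)
Lemma disconnected_disjoint_bd X Y : is_path e X -> is_path e Y ->
  disconnected e (symdiff X Y) -> [disjoint bd X & bd Y].
Proof.
move=> /path_card_bd bX /path_card_bd bY; apply: contraTT => XY.
apply: connected_of_bd; rewrite bd_symdiff (leq_trans (leq_card_setU _ _)) //.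
have : 0 < #|bd X :&: bd Y|.
  by rewrite card_gt0; apply: contra XY; rewrite setI_eq0.
have := cardsID (bd Y) (bd X); have := cardsID (bd X) (bd Y).
by rewrite bX bY [bd Y :&: _]setIC; lia.
Qed.

(** The set required to be disconnected by [spade] (a disjoint union) or [prec] (a difference of
    nested sets) is the symmetric difference. *)
Lemma phi_disjoint_bd B : phi e B ->
  {in B &, forall I J, I != J -> [disjoint bd I & bd J]}.
Proof.
case=> /subsetP Bp p0 _ I J IB JB IJ.
have pB K : K \in B -> is_path e K by move/Bp; rewrite !inE => /andP[].
apply: disconnected_disjoint_bd; try exact: pB.
have sub (A C : {set S}) : A \subset C -> symdiff A C = C :\: A.
  by move=> AC; rewrite /symdiff (eqP (_ : A :\: C == set0)) ?setD_eq0 ?set0U.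
case/or4P: (p0 I J IB JB) => [IJ'|/andP[dIJ]|
  /andP[/properP[/sub-> //]]|/andP[/properP[/sub + _]]].
- by rewrite IJ' in IJ.
- by rewrite /symdiff !(setDidPl _) // disjoint_sym.
- by rewrite /symdiff setUC => ->.
Qed.

Lemma phi_complement B : phi e B -> odd #|S| ->
  forall I, I \in B -> ~: I \in paths0 e.
Proof.
case=> /subsetP Bp _ _ oS I /Bp; rewrite !inE => /andP[pI oI].
rewrite path_of_bd ?bdC ?path_card_bd //=.
by have := cardsC I; move: oI oS; lia.
Qed.

Lemma mem_L_bd B X : ebarI X \in L B -> exists c : {set S} -> 'F_2,
  forall s, ((s \in bd X)%:R = \sum_(J in B) c J * (s \in bd J)%:R)%R.
Proof.
case/mem_L => c cE; exists c => s; rewrite mem_bd (ebarI_comb_neq s (nx s) cE).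
by apply: eq_bigr => J _; rewrite mem_bd.
Qed.

(** * Determination of [Bt] and of the counts *)

Section Phi.

Variable B : {set {set S}}.
Hypotheses (phiB : phi e B) (oddS : odd #|S|).

Lemma phi_path J : J \in B -> is_path e J.
Proof. by case: phiB => /subsetP Bp _ _ /Bp; rewrite !inE => /andP[]. Qed.

Lemma mem_L_path X : is_path e X -> ebarI X \in L B -> X \in B \/ ~: X \in B.
Proof.
move=> pX /mem_L_bd[c cE]; have bX := path_card_bd pX.
have [s sX] : exists s, s \in bd X by apply/set0Pn; rewrite -card_gt0 bX.
(* Otherwise every term of the sum at [s] vanishes, while its value is 1. *)
have [J0 [JB cJ sJ]] : exists J, [/\ J \in B, (c J != 0)%R & s \in bd J].
  have := cE s; rewrite sX.
  case: (pickP [pred J | [&& J \in B, c J != 0%R & s \in bd J]]).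
    by move=> J /and3P[] /=; exists J.
  move=> no /eqP; rewrite big1 ?oner_eq0 // => J JB.
  have := no J; rewrite /= JB /=; case: (s \in bd J); last by rewrite mulr0.
  by rewrite andbT => /negbFE/eqP ->; rewrite mul0r.
(* At an edge of [bd J0] only [J0] contributes, by disjointness, so an edge outside [bd X] would
   force [c J0] to be 0. *)
have sub : bd J0 \subset bd X.
  apply/subsetP => u uJ; apply: contraTT cJ => /negbTE uX; rewrite negbK.
  have := cE u; rewrite uX (bigD1 J0) //= uJ big1 => [|J /andP[JB' JJ]].
    by rewrite addr0 mulr1 => <-.
  have := phi_disjoint_bd phiB JB' JB JJ.
  by move/disjointFl/(_ uJ) => ->; rewrite mulr0.
have /eqP E : bd J0 == bd X by rewrite eqEcard sub bX path_card_bd // phi_path.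
by case: (bd_inj E) => <-; [left | right].
Qed.

Lemma ebarI_mem_L J : J \in B -> ebarI J \in L B.
Proof. by move=> JB; apply/memv_span/map_f; rewrite mem_enum. Qed.

(** Parity separates the alternatives of [mem_L_path]: members of [B] are odd, their complements
    even. *)
Lemma Bt_paths1 t : Bt e t B :&: paths1 e = [set I in B | t \notin I].
Proof.
apply/setP => I; rewrite !inE subsetC sub1set inE.
apply/idP/idP => [/and3P[/and3P[pI tI /(mem_L_path pI) H] _ oI]|].
  case: H => [IB | /(phi_complement phiB oddS)]; first by rewrite IB.
  by rewrite setCK !inE oI andbF.
case/andP=> IB tI; rewrite tI ebarI_mem_L // phi_path //=.
by case: phiB => /subsetP/(_ I IB) + _ _; rewrite !inE phi_path.
Qed.

Lemma Bt_paths0 t :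
  Bt e t B :&: paths0 e = [set ~: I | I in [set I in B | t \in I]].
Proof.
apply/setP => I; rewrite -[I in RHS]setCK (mem_imset _ _ (@setC_inj _)).
rewrite !inE subsetC sub1set inE.
apply/idP/idP => [/and3P[/and3P[pI tI /(mem_L_path pI) H] _ oI]|].
  case: H => [IB | -> //].
  by case: phiB => /subsetP/(_ I IB) + _ _; rewrite !inE (negbTE oI) andbF.
case/andP=> IB tI; have := phi_complement phiB oddS IB.
by rewrite setCK !inE => /andP[-> ->]; rewrite tI -ebarI_setC ebarI_mem_L.
Qed.

(** The first two terms count the members of [B] containing [s] but not [t], minus those containing
    [t] but not [s]; adding the members containing both to each count gives the difference of the
    [gcount] values. *)
Lemma fcountE t s :
  (fcount e t B s = gcount B s - gcount B t - parity (gcount B t))%R.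
Proof.
rewrite /fcount /gcount Bt_paths0 card_imset; last exact: setC_inj.
congr (_ - _)%R.
rewrite Bt_paths1.
have -> : [set I in [set ~: I | I in [set I in B | t \in I]] | s \in I]
        = [set ~: I | I in [set I in B | (t \in I) && (s \notin I)]].
  apply/setP => I; rewrite inE -[I in LHS]setCK -[I in RHS]setCK.
  by rewrite !(mem_imset _ _ (@setC_inj _)) !inE -andbA.
rewrite card_imset; last exact: setC_inj.
have := cardsID [set I : {set S} | t \in I] [set I in B | s \in I].
have := cardsID [set I : {set S} | s \in I] [set I in B | t \in I].
have -> : [set I in B | s \in I] :\: [set I : {set S} | t \in I]
        = [set I in [set I in B | t \notin I] | s \in I].
  by apply/setP => I; rewrite !inE; do 3!case: (_ \in _).
have -> : [set I in B | t \in I] :\: [set I : {set S} | s \in I]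
        = [set I in B | (t \in I) && (s \notin I)].
  by apply/setP => I; rewrite !inE; do 3!case: (_ \in _).
have -> : [set I in B | t \in I] :&: [set I : {set S} | s \in I]
        = [set I in B | s \in I] :&: [set I : {set S} | t \in I].
  by apply/setP => I; rewrite !inE; do 3!case: (_ \in _).
by move=> <- <-; rewrite !PoszD; ring.
Qed.

End Phi.

End Cycle.

(** The successor is [ordS] transported along the labelling of the cycle. *)
Lemma cycle_successor (N : nat) (S : finType) (e : rel S) :
  is_cycle_graph e N -> exists nx : S -> S,
  [/\ #|S| = N, injective nx, forall x y, fconnect nx x y
    & forall x y, e x y = (y == nx x) || (x == nx y)].
Proof.
case=> f [g fK gK] eE; exists (fun x => f (ordS (g x))); split.
- by rewrite -[RHS]card_ord; apply/esym/(bij_eq_card (f := f)); exists g.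
- by move=> x y /(can_inj fK)/ordS_inj/(can_inj gK).
- move=> x y; set nx := fun _ => _.
  have it k i : g (iter k nx (f i)) = (i + k) %% N :> nat.
    elim: k => [|k IH] /=; first by rewrite fK addn0 modn_small.
    by rewrite fK /= IH -addn1 modnDml addn1 addnS.
  (* The first [N - g x] steps lead to index 0, the next [g y] to [y]. *)
  suff -> : y = iter (N - g x + g y) nx x by apply: fconnect_iter.
  rewrite -[RHS]gK -[LHS]gK; congr f; apply: ord_inj.
  rewrite -[x in RHS]gK it fK addnA subnKC ?modnDl ?modn_small //; exact: ltnW.
- move=> x y; rewrite -{1}[x]gK -{1}[y]gK eE.
  by rewrite -!(inj_eq (can_inj fK)) !gK.
Qed.

(** * Triangular numbers modulo 2 and the conclusion *)

Local Open Scope ring_scope.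

Lemma half_mod2_shift (m k : int) : half_mod2 (m - k * 2) = half_mod2 m + k%:~R.
Proof.
rewrite /half_mod2.
(* Half of the change is put in the form [k] plus an even number. *)
have -> : (m - k * 2) * (m - k * 2 + 1)
        = (k - 2 * (k * (m + 1) - k ^+ 2)) * 2 + m * (m + 1) by ring.
rewrite divzMDl // intrD addrC intrB intrM.
by rewrite (_ : 2%:~R = 0 :> 'F_2) ?mul0r ?subr0 //; apply/eqP.
Qed.

(** With [k] equal to [m / 2] rounded up, [m - k * 2] is 0 or -1, a root of the product defining
    [half_mod2]. *)
Lemma parity_shift (m : int) : exists2 k : int,
  m + parity m = k * 2 & half_mod2 (m - k * 2) = 0.
Proof.
rewrite /parity; case: ifP => m2; [exists (m %/ 2)%Z | exists ((m + 1) %/ 2)%Z];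
  try lia.
  by rewrite (_ : m - _ = 0) //; lia.
by rewrite (_ : m - _ = -1) //; lia.
Qed.


Theorem mainTheorem3 (N : nat) (S : finType) (e : rel S)
    (hN : (3 <= N)%N) (oddN : odd N) (cycS : is_cycle_graph e N) (t : S)
    (B : {set {set S}}) (hB : phi e B) :
  eps' e t B = \sum_(s : S) half_mod2 (gcount B s) *: ebar s.
Proof.
have [nx [cS nx_inj nx_conn eE]] := cycle_successor cycS.
have S_gt2 : (2 < #|S|)%N by rewrite cS.
have oddS : odd #|S| by rewrite cS.
have [k kE kt] := parity_shift (gcount B t).
have fE s : fcount e t B s = gcount B s - k * 2.
  by rewrite (fcountE nx_inj nx_conn eE S_gt2 hB oddS) -kE opprD addrA.
(* The term at [t] can be added, its coefficient being 0 by [kt]. *)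
transitivity (\sum_s half_mod2 (fcount e t B s) *: ebar s).
  rewrite [RHS](bigD1 t) //= fE kt scale0r add0r /eps'.
  by apply: eq_bigl => s; rewrite !inE.
transitivity (\sum_s half_mod2 (gcount B s) *: ebar s
              + k%:~R *: \sum_s ebar s : Vbar S); last first.
  by rewrite sum_ebar scaler0 addr0.
rewrite scaler_sumr -big_split /=; apply: eq_bigr => s _.
by rewrite fE half_mod2_shift scalerDl.
Qed.
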